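(* Suppose an evaluator has accuracy $\alpha$ on a balanced dataset $X$ of size $N$ with binary labels $Y=\{0,1\}$. Assume the evaluator always lies on any $x\in X$ if and only if it incorrectly labels that datapoint. Then if the No-Data Algorithm is run with flip probability $\phi$ and the EV protocol is run for $r$ rounds, the expected accuracy of the No-Data Algorithm on $X$ satisfies $$\mathrm{E}[\text{correct}] \le 1-(1-\alpha)\left(1-\phi+\phi\left(\tfrac14\right)^r\right).$$
   Context: Datapoints are binary strings $x\in X\subset\{0,1\}^n$, labels in $Y=\{0,1\}$, and there is an unknown true labelling $f\colon X\to Y$. A criterion is a map $c\colon X\to\{0,1\}$; a rubric is given by ordered criteria $\mathcal{C}=\{c_1,\dots,c_n\}$ and $C(x)=c_1(x)|\cdots|c_n(x)$. The total rubric $\bar{\mathcal{C}}$ additionally contains the constituent clauses of every nonlinear criterion of arity $>1$. An aggregator is $\sigma\colon\{0,1\}^n\to Y$, and $f=\sigma\circ C$. For each string $x$, $S_x$ is a fixed set of relevant substrings of $x$. EV protocol on input $x$ (evaluator $E$, verifier $V$, rubric $C$, $r$ rounds): in each round the evaluator produces $x'$ and a partial label $\tilde y'$; the verifier chooses uniformly at random one of two challenges: Challenge 1 checks $\forall s\in S_x\,\exists t\in S_{x'}\,\forall c\in\bar{\mathcal{C}}:\ c(s)=c(t)$; Challenge 2 checks $C(x')=C(x)$. On a failed challenge the protocol returns (failure, $\tilde y'$); after $r$ passed rounds it returns (success, $\tilde y'$). An evaluator that knows $f$ always passes; an evaluator that lies (does not know the label) evades detection in a round with probability $1/4$. No-Data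 Algorithm: for each $x\in X$, run the EV protocol for $r$ rounds obtaining (success, $y$). If success, output label $y$ and record a success; otherwise output $\neg y$ with probability $\phi$ (and $y$ otherwise) and record a failure. Return the list of output labels and the list of successes. Its accuracy is the fraction of output labels equal to $f(x)$. *)

(* Defs.v *)
From HB Require Import structures.
From mathcomp Require Import all_boot all_order all_algebra.

Set Implicit Arguments.
Unset Strict Implicit.
Unset Printing Implicit Defensive.
Import Order.TTheory GRing.Theory Num.Theory.
Local Open Scope ring_scope.

Section FiniteDistributions.
Variable R : realFieldType.

Record fdist (T : finType) := FDist {
  pmf :> {ffun T -> R};
  pmf_ge0 : forall t, 0 <= pmf t;
  pmf_sum1 : \sum_t pmf t = 1 }.

Definition expectation (T : finType) (d : fdist T) (g : T -> R) : R :=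
  \sum_t d t * g t.

Definition prob (T : finType) (d : fdist T) (A : pred T) : R :=
  \sum_(t | A t) d t.

Section Ret.
Variables (T : finType) (a : T).
Let ret_fun : {ffun T -> R} := [ffun t => (t == a)%:R].
Lemma ret_ge0 t : 0 <= ret_fun t. Proof. by rewrite ffunE ler0n. Qed.
Lemma ret_sum1 : \sum_t ret_fun t = 1.
Proof.
rewrite (bigD1 a) //= ffunE eqxx big1 ?addr0 // => t /negPf nta.
by rewrite ffunE nta.
Qed.
Definition dret : fdist T := FDist ret_ge0 ret_sum1.
End Ret.

Section Bind.
Variables (T U : finType) (d : fdist T) (k : T -> fdist U).
Let bind_fun : {ffun U -> R} := [ffun u => \sum_t d t * k t u].
Lemma bind_ge0 u : 0 <= bind_fun u.
Proof. by rewrite ffunE sumr_ge0 // => t _; rewrite mulr_ge0 ?pmf_ge0. Qed.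
Lemma bind_sum1 : \sum_u bind_fun u = 1.
Proof.
under eq_bigr do rewrite ffunE.
rewrite exchange_big /= -[RHS](pmf_sum1 d); apply: eq_bigr => t _.
by rewrite -mulr_sumr pmf_sum1 mulr1.
Qed.
Definition dbind : fdist U := FDist bind_ge0 bind_sum1.
End Bind.

Section Bernoulli.
Variables (p : R) (p01 : 0 <= p <= 1).
Let bern_fun : {ffun bool -> R} := [ffun b => if b then p else 1 - p].
Lemma bern_ge0 b : 0 <= bern_fun b.
Proof. by rewrite ffunE; case/andP: p01 => p0 p1; case: b; rewrite ?subr_ge0. Qed.
Lemma bern_sum1 : \sum_b bern_fun b = 1.
Proof. by rewrite big_bool !ffunE /= addrC subrK. Qed.
Definition bernoulli : fdist bool := FDist bern_ge0 bern_sum1.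
End Bernoulli.

Lemma half01 : 0 <= (1 / 2%:R : R) <= 1.
Proof. by rewrite divr_ge0 ?ler0n // ler_pdivrMr ?ltr0n // mul1r ler1n. Qed.

Definition coin : fdist bool := bernoulli half01.

End FiniteDistributions.

(* Criteria are applied to whole datapoints and to substrings of them, so their
   domain is the set of all binary strings. *)
Record criterion := Criterion {
  arity : nat;
  clauses : arity.-tuple (seq bool -> bool);
  combine : arity.-tuple bool -> bool }.

Definition crit_eval (c : criterion) (s : seq bool) : bool :=
  combine [tuple of [seq q s | q <- clauses c]].

(* Linear in the usual sense for Boolean functions (constant term allowed):
   a0 + a_1 v_1 + ... + a_m v_m over GF(2). *)
Definition linear_bool (m : nat) (g : m.-tuple bool -> bool) : bool :=
  [exists a0 : bool, exists a : m.-tuple bool, forall v : m.-tuple bool,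
     g v == a0 (+) \big[addb/false]_(i < m) (tnth a i && tnth v i)].

Definition rubric (k : nat) := k.-tuple criterion.

Definition rubric_eval (k : nat) (C : rubric k) (s : seq bool) : k.-tuple bool :=
  [tuple of [seq crit_eval c s | c <- C]].

Definition total_rubric (k : nat) (C : rubric k) : seq (seq bool -> bool) :=
  [seq crit_eval c | c <- C] ++
  flatten [seq tval (clauses c) | c <- C &
                 ~~ linear_bool (@combine c) && (1 < arity c)%N].

Section Protocol.
Variables (R : realFieldType) (n k : nat).

Notation string := (n.-tuple bool).

Variables (S : string -> seq (seq bool)) (C : rubric k).

Definition challenge1 (x x' : string) : bool :=
  all (fun s => has (fun t => all (fun c => c s == c t) (total_rubric C))
                    (S x'))
      (S x).

Definition challenge2 (x x' : string) : bool :=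
  rubric_eval C x' == rubric_eval C x.

(* A round (x', y', b): the evaluator's move (x', y'), and the verifier's choice
   b of challenge (false for the first one, true for the second one). *)
Definition round := (string * bool * bool)%type.

Definition passes (x : string) (rd : round) : bool :=
  let: (x', _, b) := rd in if b then challenge2 x x' else challenge1 x x'.

(* [label x] is the evaluator's label for x, [lies x] says that it does not know
   the label of x, and [move x h] is its randomised next move (x', y') on input x
   after the earlier rounds h (latest first). *)
Record evaluator := Evaluator {
  label : string -> bool;
  lies : pred string;
  move : string -> seq round -> fdist R (string * bool)%type }.

Variable E : evaluator.

Definition ev_round (x : string) (h : seq round) : fdist R round :=
  dbind (move E x h) (fun m => dbind (coin R) (fun b => dret R (m, b))).

Definition pass_prob (x : string) (h : seq round) : R :=
  prob (ev_round x h) (passes x).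

(* A round takes place only if all earlier ones were passed. *)
Definition evades_with_prob (p : R) (x : string) : Prop :=
  forall h, all (passes x) h -> pass_prob x h = p.

Definition always_passes (x : string) : Prop := evades_with_prob 1 x.

Definition announces_label (x : string) : Prop :=
  forall h, all (passes x) h ->
  forall m, 0 < move E x h m -> m.2 = label E x.

(* [y] is the last label announced. *)
Fixpoint ev_run (x : string) (r : nat) (h : seq round) (y : bool) :
    fdist R (bool * bool)%type :=
  if r is r'.+1 then
    dbind (ev_round x h) (fun rd =>
      if passes x rd then ev_run x r' (rd :: h) rd.1.2
      else dret R (false, rd.1.2))
  else dret R (true, y).

(* The initial value of y matters only when r = 0. *)
Definition ev_protocol (r : nat) (x : string) : fdist R (bool * bool)%type :=
  ev_run x r [::] (label E x).

Variables (r : nat) (phi : R) (phi01 : 0 <= phi <= 1).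

Definition no_data_point (x : string) : fdist R (bool * bool)%type :=
  dbind (ev_protocol r x) (fun out =>
    let: (success, y) := out in
    if success then dret R (y, true)
    else dbind (bernoulli phi01) (fun flip =>
           dret R (if flip then ~~ y else y, false))).

Fixpoint no_data (xs : seq string) :
    fdist R ((size xs).-tuple bool * (size xs).-tuple bool)%type :=
  if xs is x :: xs' then
    dbind (no_data_point x) (fun o =>
      dbind (no_data xs') (fun os =>
        dret R ([tuple of o.1 :: os.1], [tuple of o.2 :: os.2])))
  else dret R ([tuple], [tuple]).

Definition accuracy (f : string -> bool) (xs : seq string) (ys : seq bool) : R :=
  (count (fun p => p.2 == f p.1) (zip xs ys))%:R / (size xs)%:R.

Definition balanced (f : string -> bool) (X : {set string}) : Prop :=
  #|[set x in X | f x]| = #|[set x in X | ~~ f x]|.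

End Protocol.

(* Main.v *)
Require Import Defs.
From HB Require Import structures.
From mathcomp Require Import all_boot all_order all_algebra.
From mathcomp Require Import ring lra.

Set Implicit Arguments.
Unset Strict Implicit.
Unset Printing Implicit Defensive.
Import Order.TTheory GRing.Theory Num.Theory.
Local Open Scope ring_scope.

(* A datapoint labelled correctly is output correctly almost surely; one labelled
   wrongly is output correctly exactly when the lie is detected, which has
   probability 1 - (1/4)^r, and the announced label is then flipped. By linearity
   of expectation the bound is an equality as soon as the dataset is nonempty. *)

Section Expectation.
Variable R : realFieldType.
Implicit Types T U : finType.

Lemma expectation_dret T (a : T) (g : T -> R) : expectation (dret R a) g = g a.
Proof.
rewrite /expectation (bigD1 a) //= ffunE eqxx mul1r big1 ?addr0 // => t nta.
by rewrite ffunE (negPf nta) mul0r.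
Qed.

Lemma expectation_dbind T U (d : fdist R T) (k : T -> fdist R U) (g : U -> R) :
  expectation (dbind d k) g = expectation d (fun t => expectation (k t) g).
Proof.
rewrite /expectation.
under eq_bigr do rewrite ffunE mulr_suml.
rewrite exchange_big; apply: eq_bigr => t _ /=.
by rewrite mulr_sumr; apply: eq_bigr => u _; rewrite mulrA.
Qed.

Lemma expectation_bernoulli (p : R) (p01 : 0 <= p <= 1) (g : bool -> R) :
  expectation (bernoulli p01) g = p * g true + (1 - p) * g false.
Proof. by rewrite /expectation big_bool !ffunE. Qed.

(** Values of probability zero contribute nothing. This is needed because [announces_label]
    constrains only moves of positive probability. *)
Lemma eq_expectation_supp T (d : fdist R T) (g1 g2 : T -> R) :
  (forall t, 0 < d t -> g1 t = g2 t) -> expectation d g1 = expectation d g2.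
Proof.
move=> eqg; apply: eq_bigr => t _.
have := pmf_ge0 d t; rewrite le_eqVlt => /predU1P[<-|/eqg->//].
by rewrite !mul0r.
Qed.

Lemma expectation_const T (d : fdist R T) (a : R) : expectation d (fun=> a) = a.
Proof. by rewrite /expectation -mulr_suml pmf_sum1 mul1r. Qed.

Lemma expectationD T (d : fdist R T) (g1 g2 : T -> R) :
  expectation d (fun t => g1 t + g2 t) = expectation d g1 + expectation d g2.
Proof. by rewrite /expectation -big_split; apply: eq_bigr => t _; rewrite mulrDr. Qed.

Lemma expectationZr T (d : fdist R T) (g : T -> R) (a : R) :
  expectation d (fun t => g t * a) = expectation d g * a.
Proof. by rewrite /expectation mulr_suml; apply: eq_bigr => t _; rewrite mulrA. Qed.

Lemma expectation_if T (d : fdist R T) (A : pred T) (a b : R) :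
  expectation d (fun t => if A t then a else b) = prob d A * a + (1 - prob d A) * b.
Proof.
(* Writing 1 as the total mass turns [1 - prob d A] into the mass of the complement of [A]. *)
rewrite -(pmf_sum1 d) (bigID A) /= /prob [X in (X - _) * _]addrC addrK.
rewrite /expectation (bigID A) /= !mulr_suml.
by congr (_ + _); apply: eq_bigr => t; [move=> -> | move/negPf=> ->].
Qed.

End Expectation.

Section NoData.
Variables (R : realFieldType) (n k : nat).
Variables (S : n.-tuple bool -> seq (seq bool)) (C : rubric k).
Variables (E : evaluator R n) (r : nat) (phi : R) (phi01 : 0 <= phi <= 1).

Lemma eq_expectation_ev_round x h (g1 g2 : round n -> R) :
  (forall rd, 0 < move E x h rd.1 -> g1 rd = g2 rd) ->
  expectation (ev_round E x h) g1 = expectation (ev_round E x h) g2.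
Proof.
move=> eqg; rewrite !expectation_dbind; apply: eq_expectation_supp => m m_gt0.
rewrite !expectation_dbind; apply: eq_bigr => b _.
by rewrite !expectation_dret eqg.
Qed.

(** Given any passed history, the next round is passed with probability [p], so the factors multiply
    although moves may depend on earlier rounds. The announced label never changes, hence only two
    outcomes have positive weight. *)
Lemma expectation_ev_run (p : R) x s h (g : bool * bool -> R) :
  announces_label S C E x -> evades_with_prob S C E p x -> all (passes S C x) h ->
  expectation (ev_run S C E x s h (label E x)) g =
    p ^+ s * g (true, label E x) + (1 - p ^+ s) * g (false, label E x).
Proof.
move=> Elab Ep; elim: s h => [|s IHs] h hpass /=.
  by rewrite expectation_dret expr0; ring.
rewrite expectation_dbind.
(* By induction the continuation has the same value after every passing round, so only the
   probability of passing matters. *)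
rewrite (eq_expectation_ev_round (g2 := fun rd => if passes S C x rd then
  p ^+ s * g (true, label E x) + (1 - p ^+ s) * g (false, label E x)
  else g (false, label E x))); last first.
  move=> rd /(Elab h hpass) ->.
  case: ifP => rd_pass; last by rewrite expectation_dret.
  by rewrite IHs //= rd_pass.
by rewrite expectation_if -/(pass_prob S C E x h) Ep // exprS; ring.
Qed.

Lemma expectation_no_data_point (p : R) x (g : bool * bool -> R) :
  announces_label S C E x -> evades_with_prob S C E p x ->
  expectation (no_data_point S C E r phi01 x) g =
    p ^+ r * g (label E x, true) +
    (1 - p ^+ r) * (phi * g (~~ label E x, false) + (1 - phi) * g (label E x, false)).
Proof.
move=> Elab Ep; rewrite expectation_dbind (expectation_ev_run _ _ Elab Ep) //.
by rewrite expectation_dret expectation_dbind expectation_bernoulli !expectation_dret.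
Qed.

Lemma expectation_no_data_count (f : n.-tuple bool -> bool) xs :
  expectation (no_data S C E r phi01 xs)
    (fun out => (count (fun q => q.2 == f q.1) (zip xs out.1))%:R) =
  \sum_(x <- xs) expectation (no_data_point S C E r phi01 x)
                   (fun o => (o.1 == f x)%:R).
Proof.
elim: xs => [|x xs IHxs] /=; first by rewrite expectation_dret big_nil.
rewrite expectation_dbind big_cons -IHxs.
(* The contribution of the tail is constant in the outcome at [x], and below the contribution of [x]
   is constant in the outcome of the tail. *)
rewrite -[X in _ = _ + X](expectation_const (no_data_point S C E r phi01 x)).
rewrite -expectationD; apply: eq_bigr => o _; congr (_ * _).
rewrite expectation_dbind -[X in _ = X + _](expectation_const (no_data S C E r phi01 xs)).
rewrite -expectationD; apply: eq_bigr => os _; congr (_ * _).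
by rewrite expectation_dret /= natrD.
Qed.

(** The two cases, 1 and [phi * (1 - q ^+ r)], are merged into an expression affine in the indicator
    of a correct label, so that summing over the dataset brings in only the evaluator's accuracy. *)
Lemma expectation_point_correct (f : n.-tuple bool -> bool) (q : R) x :
  announces_label S C E x ->
  (~~ lies E x -> always_passes S C E x) ->
  (lies E x -> evades_with_prob S C E q x) ->
  (lies E x <-> label E x <> f x) ->
  expectation (no_data_point S C E r phi01 x) (fun o => (o.1 == f x)%:R) =
    phi * (1 - q ^+ r) + (label E x == f x)%:R * (1 - phi * (1 - q ^+ r)).
Proof.
move=> Elab Eknows Elies lieP; have [eqf|neqf] := eqVneq (label E x) (f x).
  have /Eknows Ep : ~~ lies E x by apply/negP => /lieP; apply.
  by rewrite (expectation_no_data_point _ Elab Ep) /= eqf eqxx expr1n subrr mul0r /=; ring.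
have /Elies Ep : lies E x by apply/lieP/eqP.
rewrite (expectation_no_data_point _ Elab Ep) /= (negPf neqf).
(* Labels are binary, so flipping a wrong one corrects it. *)
have -> : ~~ label E x == f x by move: neqf; case: (label E x) (f x) => [] [].
by rewrite /=; ring.
Qed.

End NoData.

Theorem theorem1 (R : realFieldType) (n k N r : nat)
  (X : {set n.-tuple bool}) (f : n.-tuple bool -> bool)
  (S : n.-tuple bool -> seq (seq bool)) (C : rubric k)
  (sigma : k.-tuple bool -> bool)
  (E : evaluator R n) (alpha phi : R) (phi01 : 0 <= phi <= 1)
  (hS : forall x s, s \in S x -> infix s x)
  (hf : forall x, x \in X -> f x = sigma (rubric_eval C x))
  (hN : #|X| = N)
  (hbal : balanced f X)
  (halpha : accuracy R f (enum X) [seq label E x | x <- enum X] = alpha)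
  (hlabel : forall x, x \in X -> announces_label S C E x)
  (hknows : forall x, x \in X -> ~~ lies E x -> always_passes S C E x)
  (hlies : forall x, x \in X -> lies E x ->
     evades_with_prob S C E (1 / 4%:R) x)
  (hlie_iff : forall x, x \in X -> (lies E x <-> label E x <> f x)) :
  expectation (no_data S C E r phi01 (enum X))
      (fun out => accuracy R f (enum X) out.1)
    <= 1 - (1 - alpha) * (1 - phi + phi * (1 / 4%:R) ^+ r).
Proof.
have [phi0 phi1] := andP phi01.
set q : R := 1 / 4%:R.
have q01 : 0 <= q <= 1 by rewrite /q; lra.
(* This serves the empty dataset, where the claim reduces to [0 <= phi * (1 - q ^+ r)]. *)
have qr1 : q ^+ r <= 1 by case/andP: q01 => *; rewrite exprn_ile1.
rewrite expectationZr expectation_no_data_count.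
rewrite (eq_big_seq (fun x => phi * (1 - q ^+ r) +
    (label E x == f x)%:R * (1 - phi * (1 - q ^+ r)))); last first.
  move=> x; rewrite mem_enum => xX.
  by apply: expectation_point_correct; auto.
(* The indicators add up to the numerator of [alpha]. *)
have count_label : (count (fun p => p.2 == f p.1)
    (zip (enum X) [seq label E x | x <- enum X]))%:R =
    \sum_(x <- enum X) (label E x == f x)%:R :> R.
  by elim: (enum X) => [|x s IHs] /=; rewrite ?big_nil // big_cons natrD IHs.
rewrite big_split /= big_const_seq count_predT iter_addr_0 -mulr_suml -count_label.
move: halpha; rewrite /accuracy; case: (size _) => [|m] <-.
  (* On the empty dataset both accuracies are the junk value 0 / 0 = 0. *)
  by rewrite invr0 !mulr0; nra.
have : m.+1%:R != 0 :> R by rewrite pnatr_eq0.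
rewrite -[phi * _ *+ _]mulr_natr; move: (m.+1%:R) => M M0.
(* With [d = phi * (1 - q ^+ r)], both sides equal [d + alpha * (1 - d)]. *)
by rewrite le_eqVlt; apply/orP; left; apply/eqP; field.
Qed.
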